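(* Let $\mathsf{K}$ be a class of algebras that contains two (distinct) trivial algebras and is closed under Płonka sums. Then there is no protoalgebraic logic $\vdash$ such that $\mathrm{Alg}(\vdash)=\mathsf{K}$.
   Context: Fix an algebraic language without constant symbols. A logic is a substitution-invariant consequence relation $\vdash$ on formulas. A matrix $\langle\mathbf{A},F\rangle$ is a model of $\vdash$ if $\Gamma\vdash\varphi$ and $h[\Gamma]\subseteq F$ (homomorphism $h$ from the formula algebra) imply $h(\varphi)\in F$; $F$ is then a $\vdash$-filter. $\Omega^{\mathbf{A}}F$ is the largest congruence of $\mathbf{A}$ compatible with $F$; the Suszko congruence is the intersection of $\Omega^{\mathbf{A}}G$ over $\vdash$-filters $G\supseteq F$; $\mathrm{Alg}(\vdash)$ is the class of algebras $\mathbf{A}$ such that some model $\langle\mathbf{A},F\rangle$ of $\vdash$ has identity Suszko congruence. $\vdash$ is protoalgebraic if there is a set of formulas $\Delta(x,y)$ with $\emptyset\vdash\Delta(x,x)$ and $x,\Delta(x,y)\vdash y$. A trivial algebra is a one-element algebra. A directed system of algebras consists of a semilattice $\langle I,\vee\rangle$ (order $i\le j$ iff $i\vee j=j$), algebras $\mathbf{A}_i$ with pairwise disjoint universes and homomorphisms $f_{ij}\colon\mathbf{A}_i\to\mathbf{A}_j$ for $i\le j$, with $f_{ii}=\mathrm{id}$ and $f_{ik}=f_{jk}\circ f_{ij}$; its Płonka sum is the algebra with universe $\bigcup_iA_i$ and $f(a_1,\dots,a_n)=f^{\mathbf{A}_j}(f_{i_1j}(a_1),\dots,f_{i_nj}(a_n))$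 for $a_k\in A_{i_k}$, $j=i_1\vee\dots\vee i_n$. A class is closed under Płonka sums if it contains the Płonka sum of every directed system of algebras from the class. *)

(* Defs.v *)
From Stdlib Require Import Relation_Operators.
From mathcomp Require Import all_boot all_order.
From mathcomp Require Import boolp classical_sets.

Set Implicit Arguments.
Unset Strict Implicit.
Unset Printing Implicit Defensive.

Import Order.LTheory.

Local Open Scope classical_set_scope.

(* [arity_gt0]: there are no constant symbols. *)
Record language := Language {
  symbol : Type;
  arity : symbol -> nat;
  arity_gt0 : forall f, (0 < arity f)%N }.

Definition operations (L : language) (T : Type) :=
  forall f : symbol L, ('I_(arity f) -> T) -> T.

Definition is_hom (L : language) (S T : Type)
    (opS : operations L S) (opT : operations L T) (h : S -> T) : Prop :=
  forall f (a : 'I_(arity f) -> S), h (opS f a) = opT f (fun k => h (a k)).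

(* Algebras are taken with their universes as nonempty subsets of an ambient
   type [U] of individuals, as in set theory: this is what gives a meaning to
   "distinct" one-element algebras and to "pairwise disjoint universes",
   neither of which is meaningful for bare types. *)
Record algebra (L : language) (U : Type) := Algebra {
  universe :> set U;
  universe_neq0 : universe !=set0;
  op : operations L universe }.

Arguments op {L U} A f _ : rename.

Definition is_trivial (L : language) (U : Type) (A : algebra L U) : Prop :=
  exists u : U, universe A = [set u].

Inductive formula (L : language) : Type :=
| Var of nat
| App (f : symbol L) of ('I_(arity f) -> formula L).

Arguments Var L n : clear implicits.
Arguments App {L} f t.

Fixpoint subst (L : language) (s : nat -> formula L) (phi : formula L)
    : formula L :=
  match phi with
  | Var n => s n
  | App f t => App f (fun k => subst s (t k))
  end.

Fixpoint vars (L : language) (phi : formula L) : set nat :=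
  match phi with
  | Var n => [set n]
  | App f t => \bigcup_k vars (t k)
  end.

Record logic (L : language) := Logic {
  entails :> set (formula L) -> formula L -> Prop;
  entails_refl : forall Gamma phi, Gamma phi -> entails Gamma phi;
  entails_cut : forall Gamma Delta phi,
    (forall psi, Delta psi -> entails Gamma psi) ->
    entails Delta phi -> entails Gamma phi;
  entails_subst : forall (s : nat -> formula L) Gamma phi,
    entails Gamma phi -> entails (subst s @` Gamma) (subst s phi) }.

(* [Delta] is a set of formulas in the variables x = Var 0 and y = Var 1;
   Delta(x,x) is the image of [Delta] under the substitution y := x. *)
Definition protoalgebraic (L : language) (turnstile : logic L) : Prop :=
  exists Delta : set (formula L),
    [/\ forall delta, Delta delta -> vars delta `<=` [set 0%N; 1%N],
        forall delta, Delta delta ->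
          turnstile set0 (subst (fun=> Var L 0) delta) &
        turnstile (Var L 0 |` Delta) (Var L 1)].

Section Models.
Variables (L : language) (U : Type).

Definition is_filter (turnstile : logic L) (A : algebra L U) (F : set A)
    : Prop :=
  forall (Gamma : set (formula L)) (phi : formula L) (h : formula L -> A),
    turnstile Gamma phi -> is_hom (@App L) (op A) h ->
    h @` Gamma `<=` F -> F (h phi).

Definition congruence (A : algebra L U) (theta : A -> A -> Prop) : Prop :=
  [/\ forall a, theta a a,
      forall a b, theta a b -> theta b a,
      forall a b c, theta a b -> theta b c -> theta a c &
      forall f (a b : 'I_(arity f) -> A),
        (forall k, theta (a k) (b k)) -> theta (op A f a) (op A f b)].

Definition compatible (A : algebra L U) (theta : A -> A -> Prop) (F : set A)
    : Prop :=
  forall a b, theta a b -> F a -> F b.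

(* The union of all congruences compatible with [F]; it is itself such a
   congruence, hence the largest one: see [leibniz_largest] below. *)
Definition leibniz (A : algebra L U) (F : set A) (a b : A) : Prop :=
  exists theta, [/\ congruence theta, compatible theta F & theta a b].

Lemma leibniz_largest (A : algebra L U) (F : set A) :
  [/\ congruence (leibniz F), compatible (leibniz F) F &
      forall theta, congruence theta -> compatible theta F ->
        forall a b, theta a b -> leibniz F a b].
Proof.
pose T := Relation_Operators.clos_refl_trans A (leibniz F).
have Tcong : congruence T.
  split=> [a|a b|a b c|f a b Tab].
  - exact: Relation_Operators.rt_refl.
  - elim=> [{}a {}b [th [cth Fth ab]]|{}a|{}a {}b c _ ? _ ?].
    + apply: Relation_Operators.rt_step; exists th; split=> //.
      by case: cth => _ sym _ _; apply: sym.
    + exact: Relation_Operators.rt_refl.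
    + by apply: Relation_Operators.rt_trans; eassumption.
  - exact: Relation_Operators.rt_trans.
  - (* replace the arguments [a k] by [b k] one at a time *)
    pose c m (k : 'I_(arity f)) := if (k < m)%N then b k else a k.
    have Tc m : (m <= arity f)%N -> T (op A f (c 0%N)) (op A f (c m)).
      elim: m => [_|m IHm lt_m]; first exact: Relation_Operators.rt_refl.
      apply: Relation_Operators.rt_trans (IHm (ltnW lt_m)) _.
      pose m' := Ordinal lt_m.
      pose e x (k : 'I_(arity f)) := if k == m' then x else c m k.
      have -> : c m = e (a m').
        apply: funext => k; rewrite /e /c; case: eqP => // ->.
        by rewrite ltnn.
      have -> : c m.+1 = e (b m').
        apply: funext => k; rewrite /e /c ltnS leq_eqVlt.
        by rewrite -[_ == m :> nat]/(k == m'); case: eqP => [->|].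
      elim: (Tab m') => [x y [th [cth Fth xy]]|x|x y z _ ? _ ?].
      + apply: Relation_Operators.rt_step; exists th; split=> //.
        case: cth => refl _ _ cong; apply: cong => k.
        by rewrite /e; case: eqP => _; [exact: xy|exact: refl].
      + exact: Relation_Operators.rt_refl.
      + by apply: Relation_Operators.rt_trans; eassumption.
    have := Tc (arity f) (leqnn _).
    have -> : c 0%N = a by apply: funext => k; rewrite /c ltn0.
    by have -> : c (arity f) = b by apply: funext => k; rewrite /c ltn_ord.
have Tcomp : compatible T F.
  move=> a b; elim=> // [x y [th [_ Fth xy]]|x y z _ IH1 _ IH2 Fx].
    exact: Fth xy.
  exact/IH2/IH1.
have -> : leibniz F = T.
  apply: funext => a; apply: funext => b; apply: propext; split=> Lab.
    exact: Relation_Operators.rt_step.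
  by exists T.
by split=> // th cth Fth a b ab; apply: Relation_Operators.rt_step; exists th.
Qed.

Definition suszko (turnstile : logic L) (A : algebra L U) (F : set A)
    (a b : A) : Prop :=
  forall G : set A, is_filter turnstile G -> F `<=` G -> leibniz G a b.

Definition Alg (turnstile : logic L) : set (algebra L U) :=
  [set A : algebra L U | exists F : set A,
     is_filter turnstile F /\ forall a b, suszko turnstile F a b <-> a = b].

End Models.

Arguments Alg {L} U turnstile.

Record directed_system (L : language) (U : Type) (d : Order.disp_t)
    (I : joinSemilatticeType d) := DirectedSystem {
  component :> I -> algebra L U;
  component_disjoint : trivIset setT (fun i => universe (component i));
  transition : forall i j : I, (i <= j)%O -> component i -> component j;
  transition_hom : forall i j (le_ij : (i <= j)%O),
    is_hom (op (component i)) (op (component j)) (transition le_ij);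
  transition_id : forall i (le_ii : (i <= i)%O) a, transition le_ii a = a;
  transition_comp : forall i j k
      (le_ij : (i <= j)%O) (le_jk : (j <= k)%O) (le_ik : (i <= k)%O) a,
    transition le_ik a = transition le_jk (transition le_ij a) }.

(* The join of a nonempty finite family; its first member serves as the
   initial value of the iteration, since [I] may lack a bottom. *)
Definition joins (d : Order.disp_t) (I : joinSemilatticeType d) (n : nat)
    (n_gt0 : (0 < n)%N) (i : 'I_n -> I) : I :=
  \big[Order.join/i (Ordinal n_gt0)]_(k < n) i k.

Lemma le_joins (d : Order.disp_t) (I : joinSemilatticeType d) (n : nat)
    (n_gt0 : (0 < n)%N) (i : 'I_n -> I) (k : 'I_n) :
  (i k <= joins n_gt0 i)%O.
Proof.
rewrite /joins; move: (i (Ordinal n_gt0)) => i0.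
have: k \in index_enum 'I_n by rewrite mem_index_enum.
elim: (index_enum _) => // l s IHs; rewrite in_cons big_cons.
case/predU1P => [->|/IHs le_k]; first exact: leUl.
exact: le_trans le_k (leUr _ _).
Qed.

(* The operation is specified on arguments [b k] given through their
   representatives [a k] in the components; this determines [P], which always
   exists for a nonempty [I]: see [plonka_sum_exists_unique] below. *)
Definition is_plonka_sum (L : language) (U : Type) (d : Order.disp_t)
    (I : joinSemilatticeType d) (S : directed_system L U I) (P : algebra L U)
    : Prop :=
  universe P = \bigcup_i universe (S i) /\
  forall (f : symbol L) (i : 'I_(arity f) -> I)
      (a : forall k, S (i k)) (b : 'I_(arity f) -> P),
    (forall k, val (b k) = val (a k)) ->
    val (op P f b) =
    val (op (S (joins (arity_gt0 f) i)) f
            (fun k => transition (le_joins (arity_gt0 f) i k) (a k))).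

Definition closed_under_plonka_sums (L : language) (U : Type)
    (K : set (algebra L U)) : Prop :=
  forall (d : Order.disp_t) (I : joinSemilatticeType d)
      (S : directed_system L U I) (P : algebra L U),
    (forall i, K (S i)) -> is_plonka_sum S P -> K P.

Lemma plonka_sum_exists_unique (L : language) (U : Type) (d : Order.disp_t)
    (I : joinSemilatticeType d) (S : directed_system L U I) :
  inhabited I -> exists! P : algebra L U, is_plonka_sum S P.
Proof.
case=> i0.
pose u : set U := \bigcup_i universe (S i).
have idxP (x : u) : {i | universe (S i) (val x)}.
  by apply: cid; case: x => x /= /set_mem [i _ Six]; exists i.
pose idx x := sval (idxP x).
pose cmp x : S (idx x) := exist _ (val x) (mem_set (svalP (idxP x))).
have u0 : u !=set0.
  by case: (universe_neq0 (S i0)) => x Sx; exists x, i0.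
have inu j (x : S j) : val x \in u by apply/mem_set; exists j => //; apply: set_valP.
pose opu : operations L u := fun f b =>
  let r := op (S (joins (arity_gt0 f) (fun k => idx (b k)))) f
     (fun k => transition (le_joins (arity_gt0 f) (fun k => idx (b k)) k)
                 (cmp (b k))) in
  exist _ (val r) (inu _ r).
exists (Algebra u0 opu); split.
  split=> // f i a b ab.
  have Ei : i = fun k => idx (b k).
    apply: funext => k.
    have := @component_disjoint _ _ _ _ S; apply=> //.
    exists (val (b k)); split; last exact: svalP (idxP (b k)).
    by rewrite ab; apply: set_valP.
  subst i; suff -> : a = fun k => cmp (b k) by [].
  by apply: functional_extensionality_dep => k; apply: val_inj; rewrite -ab.
case=> u' u'0 op' [/= Eu' opP']; move: u'0 op' opP'; rewrite {}Eu' -/u.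
move=> u'0 op' opP'; have -> : op' = opu.
  apply: functional_extensionality_dep => f; apply: funext => b.
  exact/val_inj/(opP' f _ (fun k => cmp (b k))).
by congr Algebra; apply: Prop_irrelevance.
Qed.

(* Main.v *)
Require Import Defs.
From mathcomp Require Import all_boot all_order.
From mathcomp Require Import boolp classical_sets.

(** The Płonka sum of two distinct trivial algebras over the two-element chain
    is a two-element idempotent algebra, as there are no constants.  In an
    idempotent algebra every theorem takes each element [c] as a value, under
    the constant assignment [c].  Hence a filter is everything as soon as the
    logic has a theorem; if a protoalgebraic logic has none then [Delta] is
    empty, [x] entails [y], and a filter is empty or everything.  So all
    Leibniz congruences are total, and so is the Suszko congruence. *)

Set Implicit Arguments.
Unset Strict Implicit.
Unset Printing Implicit Defensive.

Import Order.LTheory.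

Local Open Scope classical_set_scope.

Definition idempotent_algebra (L : language) (U : Type) (A : algebra L U)
    : Prop :=
  forall f (a : A), op A f (fun=> a) = a.

Section Evaluation.
Variables (L : language) (U : Type) (A : algebra L U).

Fixpoint eval (v : nat -> A) (phi : formula L) : A :=
  match phi with
  | Var n => v n
  | App f t => op A f (fun k => eval v (t k))
  end.

Lemma eval_hom v : is_hom (@App L) (op A) (eval v).
Proof. by []. Qed.

Lemma eval_idempotent (c : A) phi :
  idempotent_algebra A -> eval (fun=> c) phi = c.
Proof.
move=> idemA; elim: phi => //= f t IHt.
by rewrite (_ : (fun k => _) = fun=> c) //; apply: funext.
Qed.

End Evaluation.

Section Idempotent.
Variables (L : language) (U : Type) (A : algebra L U) (turnstile : logic L).
Hypotheses (protoL : protoalgebraic turnstile) (idemA : idempotent_algebra A).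

Lemma idempotent_filter (G : set A) (c d : A) :
  is_filter turnstile G -> G c -> G d.
Proof.
have [Delta [_ DeltaI DeltaMP]] := protoL.
move=> filtG Gc; case: (pselect (exists delta, Delta delta)) => [[delta Dd]|D0].
  rewrite -(eval_idempotent d (subst (fun=> Var L 0) delta) idemA).
  apply: filtG (DeltaI _ Dd) (@eval_hom _ _ _ _) _.
  by move=> _ [psi []].
(* With [Delta] empty, [DeltaMP] says that x entails y; [v] sends x to [c] and y to [d]. *)
pose v n := if n is 0%N then c else d.
apply: (filtG _ _ _ DeltaMP (@eval_hom _ _ _ v)).
by move=> _ [psi [->|Dpsi] <-] //; case: D0; exists psi.
Qed.

Lemma idempotent_Alg (a b : A) : Alg U turnstile A -> a = b.
Proof.
case=> F [_ suszkoF]; apply/suszkoF => G filtG _.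
(* The total relation is a congruence, compatible with [G] because a nonempty filter contains every
   element. *)
by exists (fun _ _ => True); split=> // c d _; apply: idempotent_filter.
Qed.

End Idempotent.

Lemma trivial_algebra_eq (L : language) (U : Type) (A : algebra L U) (a b : A) :
  is_trivial A -> a = b.
Proof.
case=> u Au; have valA (x : A) : val x = u.
  by have: [set u] (val x); [rewrite -Au; apply: set_valP|].
by apply: val_inj; rewrite !valA.
Qed.

(** A one-point universe carries only one algebra structure, so distinct trivial algebras sit on
    distinct points. *)
Lemma trivial_algebras_eq (L : language) (U : Type) (A B : algebra L U) :
  is_trivial A -> universe A = universe B -> A = B.
Proof.
move=> trivA; case: A trivA => u u0 opA trivA; case: B => u' u'0 opB /= Eu.
case: _ / Eu u'0 opB => u'0 opB.
rewrite (Prop_irrelevance u'0 u0); congr Algebra.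
apply: functional_extensionality_dep => f; apply: funext => a.
exact: (@trivial_algebra_eq _ _ (Algebra u0 opA)).
Qed.

Lemma joins_cst (d : Order.disp_t) (I : joinSemilatticeType d) (n : nat)
    (n_gt0 : (0 < n)%N) (i : I) :
  joins n_gt0 (fun=> i) = i.
Proof.
rewrite /joins; apply: (big_ind (fun x => x = i)) => // x y -> ->.
exact: joinxx.
Qed.

Section TrivialSystem.
Variables (L : language) (U : Type) (d : Order.disp_t).
Variable I : joinSemilatticeType d.

(** Each transition is constant at the point of its target, and all laws are equations inside
    one-element algebras. *)
Lemma trivial_directed_system (C : I -> algebra L U) :
  (forall i, is_trivial (C i)) -> trivIset setT (fun i => universe (C i)) ->
  exists S : directed_system L U I, component S = C.
Proof.
move=> trivC disjC.
have ptC (j : I) : {x : U | x \in universe (C j)}.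
  by apply: cid; have [x Cx] := universe_neq0 (C j); exists x; apply/mem_set.
pose pt j : C j := exist _ _ (svalP (ptC j)).
have hom_pt i j : is_hom (op (C i)) (op (C j)) (fun=> pt j).
  by move=> f a; apply: trivial_algebra_eq.
have id_pt i (a : C i) : pt i = a by apply: trivial_algebra_eq.
by exists (@DirectedSystem _ _ _ _ C disjC (fun i j _ _ => pt j)
  (fun i j _ => hom_pt i j) (fun i _ => @id_pt i) (fun _ _ _ _ _ _ _ => erefl)).
Qed.

(** Equal arguments share one component, whose index is also their join, so the value is computed in
    that one-element algebra. *)
Lemma trivial_plonka_sum_idempotent (S : directed_system L U I)
    (P : algebra L U) :
  (forall i, is_trivial (S i)) -> is_plonka_sum S P -> idempotent_algebra P.
Proof.
move=> trivS [EP opP] f p.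
have [i _ Sip] : (\bigcup_i universe (S i)) (val p).
  by rewrite -EP; apply: set_valP.
pose a : S i := exist _ (val p) (mem_set Sip).
apply: val_inj; rewrite (opP f (fun=> i) (fun=> a)) //.
(* The type of [r] mentions the join, so [r] is generalized before rewriting. *)
set r := op _ _ _; move: r; rewrite joins_cst => r.
by rewrite (trivial_algebra_eq r a).
Qed.

End TrivialSystem.

Theorem theorem6p2 (L : language) (U : Type) (K : set (algebra L U))
    (two_trivial : exists A B : algebra L U,
       [/\ K A, K B, is_trivial A, is_trivial B & A <> B])
    (K_plonka : closed_under_plonka_sums K) :
  ~ exists turnstile : logic L,
      protoalgebraic turnstile /\ Alg U turnstile = K.
Proof.
case=> turnstile [protoL AlgK].
have [A [B [KA KB trivA trivB neqAB]]] := two_trivial.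
have [[a Aa] [b Bb]] := (trivA, trivB).
have neq_ab : a <> b.
  by move=> eq_ab; apply/neqAB/trivial_algebras_eq; rewrite // Aa Bb eq_ab.
(* The booleans, with [false] below [true], serve as the two-element chain. *)
pose C (i : bool) := if i then B else A.
have trivC i : is_trivial (C i) by case: i.
have disjC : trivIset setT (fun i => universe (C i)).
  by move=> [] [] _ _ //= [x []]; rewrite /= Aa Bb => -> eq_ab;
    case: neq_ab.
have [S ES] := trivial_directed_system trivC disjC.
have [P [sumP _]] := plonka_sum_exists_unique S (inhabits true).
have idemP : idempotent_algebra P.
  by apply: trivial_plonka_sum_idempotent sumP => i; rewrite ES.
have KP : K P by apply: K_plonka sumP => i; rewrite ES; case: i.
have Pab i : (if i then b else a) \in universe P.
  by apply/mem_set; rewrite (proj1 sumP); exists i => //; rewrite ES;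
    case: i; rewrite /= ?Aa ?Bb.
have eq_ab : exist _ a (Pab false) = exist _ b (Pab true) :> P.
  by apply: idempotent_Alg protoL idemP _ _ _; rewrite AlgK.
exact: neq_ab (congr1 val eq_ab).
Qed.
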